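(* Let $k>3$ be an integer and let $d=k^{2}-4$. Then all positive integer solutions $(x,y)$ of the equation $x^{2}-dy^{2}=1$ are given by $$(x,y)=\begin{cases}\left(\dfrac{V_{2n}(k,-1)}{2},\dfrac{U_{2n}(k,-1)}{2}\right) & \text{if } k \text{ is even},\\[2mm] \left(\dfrac{V_{3n}(k,-1)}{2},\dfrac{U_{3n}(k,-1)}{2}\right) & \text{if } k \text{ is odd},\end{cases}$$ with $n\geq 1$. That is, the set of pairs of positive integers solving the equation is exactly the set of these pairs as $n$ ranges over the integers $n\ge 1$.
   Context: For nonzero integers $k,s$ with $k^{2}+4s>0$, the generalized Fibonacci sequence is defined by $U_{0}(k,s)=0$, $U_{1}(k,s)=1$, $U_{n+1}(k,s)=kU_{n}(k,s)+sU_{n-1}(k,s)$ for $n\ge 1$, and the generalized Lucas sequence by $V_{0}(k,s)=2$, $V_{1}(k,s)=k$, $V_{n+1}(k,s)=kV_{n}(k,s)+sV_{n-1}(k,s)$ for $n\ge 1$. *)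

(* Defs.v *)
From mathcomp Require Import all_boot all_order all_algebra.

Set Implicit Arguments.
Unset Strict Implicit.
Unset Printing Implicit Defensive.

Import GRing.Theory.
Local Open Scope ring_scope.

(* The standing conditions k <> 0, s <> 0, k ^+ 2 + 4 * s > 0 are not needed to
   define the sequences, which are total in k and s. *)
Fixpoint genFib (k s : int) (n : nat) : int :=
  match n with
  | 0%N => 0
  | (m.+1)%N =>
      match m with
      | 0%N => 1
      | (l.+1)%N => k * genFib k s m + s * genFib k s l
      end
  end.

Fixpoint genLucas (k s : int) (n : nat) : int :=
  match n with
  | 0%N => 2
  | (m.+1)%N =>
      match m with
      | 0%N => k
      | (l.+1)%N => k * genLucas k s m + s * genLucas k s l
      end
  end.

(* Pairs of rationals, so that halving is exact and integrality of the
   coordinates is part of the condition. *)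
Definition pos_int_pell_sol (d : int) (p : rat * rat) : Prop :=
  [/\ p.1 \is a Num.int, p.2 \is a Num.int, 0 < p.1, 0 < p.2
    & p.1 ^+ 2 - d%:~R * p.2 ^+ 2 = 1].

(* Main.v *)
Require Import Defs.
From mathcomp Require Import all_boot all_order all_algebra.
From mathcomp Require Import zify ring.

(** Write U_n and V_n for the two sequences with s = -1.  Since
    V_n = 2 U_{n+1} - k U_n ([genLucas_genFib]), the substitution
    a = x + k y, b = 2 y turns x^2 - (k^2 - 4) y^2 into a^2 - k a b + b^2, and
    (x, y) = (V_n / 2, U_n / 2) says exactly that (a, b) = (U_{n+1}, U_n).

    The form a^2 - k a b + b^2 takes the value 1 at every pair of consecutive
    U's ([genFib_conic]), because it is invariant under (a, b) -> (b, k b - a),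
    the recurrence run backwards.  Conversely, a pair 0 <= b < a where the form
    is 1 is carried by that map to a smaller one, until (1, 0) = (U_1, U_0) is
    reached ([conic_genFib]).  Hence the Pell solutions correspond to the
    n >= 1 for which b = U_n is even.  Modulo 2 the sequence U has period 2 or
    3 according to the parity of k, and the even terms are those whose index is
    divisible by the period ([genFib_even]). *)

Import GRing.Theory Num.Theory.
Local Open Scope ring_scope.

Lemma genFibSS (k s : int) n :
  genFib k s n.+2 = k * genFib k s n.+1 + s * genFib k s n.
Proof. by []. Qed.

Lemma genLucasSS (k s : int) n :
  genLucas k s n.+2 = k * genLucas k s n.+1 + s * genLucas k s n.
Proof. by []. Qed.

(** Both sides satisfy the same second-order recurrence, whatever s is. *)
Lemma genLucas_genFib (k s : int) n :
  genLucas k s n = 2 * genFib k s n.+1 - k * genFib k s n.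
Proof.
suff [] : genLucas k s n = 2 * genFib k s n.+1 - k * genFib k s n /\
    genLucas k s n.+1 = 2 * genFib k s n.+2 - k * genFib k s n.+1 by [].
elim: n => [|n [IH0 IH1]]; first by split; rewrite /=; ring.
by split=> //; rewrite genLucasSS IH0 IH1 !genFibSS; ring.
Qed.

Lemma genFib_conic (k : int) n :
  genFib k (-1) n.+1 ^+ 2 - k * genFib k (-1) n.+1 * genFib k (-1) n
    + genFib k (-1) n ^+ 2 = 1.
Proof.
elim: n => [|n IH]; first by rewrite /=; ring.
by rewrite genFibSS -[RHS]IH; ring.
Qed.

Lemma genFib_increasing (k : int) n : 2 <= k ->
  0 <= genFib k (-1) n /\ genFib k (-1) n < genFib k (-1) n.+1.
Proof. by move=> k2; elim: n => [//|n [IH0 IH1]]; rewrite genFibSS; nia. Qed.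

(** Descent on b.  If b > 0, then c = k b - a satisfies a c = b^2 - 1, and with
    0 < b < a this forces 0 <= c < b, so that (b, c) is a smaller solution. *)
Lemma conic_genFib (k a b : int) :
    0 <= b -> b < a -> a ^+ 2 - k * a * b + b ^+ 2 = 1 ->
  exists n, a = genFib k (-1) n.+1 /\ b = genFib k (-1) n.
Proof.
move=> b0 ba eq1.
have [m] : exists m : nat, b < m%:Z by exists `|b|.+1%N; lia.
elim: m a b b0 ba eq1 => [|m IH] a b b0 ba eq1 bm; first by lia.
have [bz|bpos] : b = 0 \/ 0 < b by lia.
  by exists 0%N; split=> //=; nia.
have prod : a * (k * b - a) = b ^+ 2 - 1 by rewrite -[X in _ = _ - X]eq1; ring.
have c0 : 0 <= k * b - a by nia.
have cb : k * b - a < b by nia.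
have [||n [bE cE]] := IH b (k * b - a) c0 cb; [by rewrite -[RHS]eq1; ring|by lia|].
by exists n.+1; split=> //; rewrite genFibSS -bE -cE; ring.
Qed.

(** From U_{n+2} = k U_{n+1} - U_n and
    U_{n+3} = (k^2 - 1) U_{n+1} - k U_n, shifting the index by 2 (k even) or
    by 3 (k odd) preserves the parity of U. *)
Lemma genFib_even (k : int) n :
  (2 %| genFib k (-1) n)%Z = ((if (2 %| k)%Z then 2 else 3) %| n)%N.
Proof.
case: ifPn => k2.
  have [q kE] : exists q, k = 2 * q by exists (k %/ 2)%Z; lia.
  elim/ltn_ind: n => -[|[|n]] IH //; have := IH n (leqW (leqnn _)).
  have -> : genFib k (-1) n.+2
      = 2 * (q * genFib k (-1) n.+1) - genFib k (-1) n.
    by rewrite genFibSS kE; ring.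
  by lia.
have [q kE] : exists q, k = 2 * q + 1 by exists (k %/ 2)%Z; lia.
elim/ltn_ind: n => -[|[|[|n]]] IH //; first by move: k2 => /=; lia.
have := IH n (leqW (leqW (leqnn _))).
have -> : genFib k (-1) n.+3
    = 2 * ((2 * q ^+ 2 + 2 * q) * genFib k (-1) n.+1 - q * genFib k (-1) n)
      - genFib k (-1) n.
  by rewrite !genFibSS kE; ring.
by lia.
Qed.

Theorem theorem9 (k d : int) (hk : 3 < k) (hd : d = k ^+ 2 - 4)
    (x y : rat) :
  pos_int_pell_sol d (x, y) <->
  exists n : nat, (1 <= n)%N /\
    (x, y) =
      if (2 %| k)%Z
      then ((genLucas k (-1) (2 * n))%:~R / 2, (genFib k (-1) (2 * n))%:~R / 2)
      else ((genLucas k (-1) (3 * n))%:~R / 2, (genFib k (-1) (3 * n))%:~R / 2).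
Proof.
pose m := if (2 %| k)%Z then 2%N else 3%N.
have m_gt0 : (0 < m)%N by rewrite /m; case: ifP.
have -> : (exists n : nat, (1 <= n)%N /\ (x, y) =
      if (2 %| k)%Z
      then ((genLucas k (-1) (2 * n))%:~R / 2, (genFib k (-1) (2 * n))%:~R / 2)
      else ((genLucas k (-1) (3 * n))%:~R / 2, (genFib k (-1) (3 * n))%:~R / 2))
  <-> exists n : nat, (1 <= n)%N /\ (x, y) =
      ((genLucas k (-1) (m * n))%:~R / 2, (genFib k (-1) (m * n))%:~R / 2).
  by rewrite /m; case: ifP.
split.
  rewrite /pos_int_pell_sol /= => -[/intrP[X ->] /intrP[Y ->]].
  rewrite !ltr0z => X0 Y0 /eqP.
  rewrite -!rmorphXn -rmorphM -rmorphB /= (eqr_int _ _ 1) => /eqP pell.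
  (* b < a because x > 0 and k > 2. *)
  have [|||n [aE bE]] := @conic_genFib k (X + k * Y) (2 * Y).
  - by lia.
  - by nia.
  - by rewrite -[RHS]pell hd; ring.
  have /dvdnP[j nE] : (m %| n)%N by rewrite -genFib_even -bE; lia.
  exists j; split.
    by case: j nE => // nE; move: bE; rewrite nE mul0n /=; lia.
  rewrite mulnC -nE genLucas_genFib -aE -bE.
  have -> : 2 * (X + k * Y) - k * (2 * Y) = 2 * X by ring.
  by rewrite !intrM; congr pair; field.
case=> n [n0 [-> ->]].
have mn0 : (0 < m * n)%N by rewrite muln_gt0 m_gt0.
have /dvdzP[Y bE] : (2 %| genFib k (-1) (m * n))%Z.
  by rewrite genFib_even dvdn_mulr.
have b0 : 0 < genFib k (-1) (m * n).
  have [] := @genFib_increasing k (m * n).-1; rewrite ?prednK //; lia.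
have V0 : 0 < genLucas k (-1) (m * n).
  (* V_{j+1} = k U_{j+1} - 2 U_j with 0 <= U_j < U_{j+1} and k > 2. *)
  rewrite genLucas_genFib -(prednK mn0) genFibSS.
  have [] := @genFib_increasing k (m * n).-1; [by lia|by nia].
have conic := genFib_conic k (m * n).
move: V0 b0; rewrite genLucas_genFib; move: conic; rewrite bE.
set a := genFib _ _ _ => conic V0 b0.
have -> : 2 * a - k * (Y * 2) = (a - k * Y) * 2 by ring.
have half (z : int) : (z * 2)%:~R / 2 = z%:~R :> rat by rewrite intrM; field.
rewrite !half; split; rewrite ?intr_int //= ?ltr0z; [by lia|by lia|].
rewrite -!rmorphXn -rmorphM -rmorphB /=.
by rewrite -[1 in RHS]/(1%:~R) -conic hd; congr (_%:~R); ring.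
Qed.
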